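(* Let $\mathbb{F}_q$ be a finite field with $q$ elements and of odd characteristic $p$. (1) If $q=p$, then for every integer $k$ with $2\le k\le p-2$, the covering radius of the projective Reed-Solomon code $PRS(p+1,k)$ is $\rho(PRS(p+1,k))=p-k$. (2) If $q=p^2$, then for every integer $k$ with $2\le k\le 2p-3$, the covering radius of the projective Reed-Solomon code $PRS(q+1,k)$ is $\rho(PRS(q+1,k))=q-k$.
   Context: Write $\mathbb{F}_q=\{\alpha_1,\dots,\alpha_q\}$. The projective Reed-Solomon code over $\mathbb{F}_q$ of length $q+1$ and dimension $k$ is $PRS(q+1,k)=\{(f(\alpha_1),\dots,f(\alpha_q),c_{k-1}(f)) : f\in\mathbb{F}_q[x],\ \deg f\le k-1\}\subseteq \mathbb{F}_q^{q+1}$, where $c_{k-1}(f)$ is the coefficient of $x^{k-1}$ in $f$. For $u,v\in\mathbb{F}_q^n$, $d(u,v)$ is the Hamming distance (number of coordinates in which $u,v$ differ). For a linear code $C\subseteq\mathbb{F}_q^n$ and $u\in\mathbb{F}_q^n$, $d(u,C)=\min\{d(u,c): c\in C\}$, and the covering radius is $\rho(C)=\max\{d(u,C): u\in\mathbb{F}_q^n\}$. *)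

(* Defs.v *)
From mathcomp Require Import all_boot all_order all_algebra.

Set Implicit Arguments.
Unset Strict Implicit.
Unset Printing Implicit Defensive.

Import GRing.Theory.
Local Open Scope ring_scope.

Section Codes.
Variables (F : finFieldType) (n : nat).
Implicit Types (u v : 'rV[F]_n) (C : {set 'rV[F]_n}).

Definition hamming u v : nat := #|[set i : 'I_n | u 0 i != v 0 i]|.

(* The default value n of the iterated minimum bounds every Hamming distance,
   so for C nonempty this is the true minimum over C. *)
Definition dist_code u C : nat := \big[minn/n]_(c in C) hamming u c.

Definition covering_radius C : nat := (\max_(u : 'rV[F]_n) dist_code u C)%N.

End Codes.

Section ProjectiveReedSolomon.
Variables (F : finFieldType) (q : nat) (alpha : 'I_q -> F).

(* Meaningful for 0 < k only: f`_k.-1 is then the coefficient of 'X^(k - 1). *)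
Definition prs_word (k : nat) (f : {poly F}) : 'rV[F]_(q + 1) :=
  row_mx (\row_(i < q) f.[alpha i]) (const_mx f`_k.-1).

(* {poly_k F} is the finite type of the polynomials f with size f <= k, i.e.
   deg f <= k - 1, the zero polynomial included. *)
Definition PRS (k : nat) : {set 'rV[F]_(q + 1)} :=
  [set prs_word k (val f) | f : {poly_k F}].

End ProjectiveReedSolomon.

(* Main.v *)
Require Import Defs.
From mathcomp Require Import all_boot all_order all_algebra all_field.
From mathcomp Require Import ring zify.

(** The covering radius is at least q - k because 'X^k agrees with a polynomial of
    degree < k in at most k points.  Conversely, a word u = (f, c) at distance
    more than q - k from the code may be normalised to c = 0, and then no divided
    difference of f on k or on k + 1 points vanishes: the dual normal rational
    curve, enlarged by u, is an arc.  Put n = k - 1.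

    Small k.  For a set D of n points, y |-> ddiff f (D + y) is injective and
    nonzero off D; the polynomial with the missing values as roots (the
    "tangents" at D) has degree n - 1, and Wilson's theorem evaluates it at these
    values (Segre's lemma of tangents).  Comparing leading coefficients in
    Lagrange's formula gives, for every G with 2n points, a function V on
    (n + 1)-subsets with
      \sum_(y in G \ D) V (D + y) = \prod_(d in D, u in G \ D) (u - d)^-1
    for all n-subsets D of G.  There are two ways to contradict this:
    - if n + 1 < p, the sums of V over the supersets of a set A vanish for
      #|A| < n (for #|A| = n - 1 by Lagrange's formula again), so V = 0 by
      inclusion-exclusion;
    - pair the points of G and take the alternating sum over the D with one point
      in each pair: the left-hand side cancels, and the right-hand side, viewed as
      a rational function of one point, has as residue the same sum with one pair
      fewer, so it vanishes identically only if 2 = 0 (this needs about 3n points).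

    Large k.  The functional P |-> \sum_x f x * P.[x] on polynomials of degree at
    most q - k vanishes at a product of distinct linear factors (Seroussi and
    Roth); the complement of the roots supports a vanishing divided difference. *)

Import GRing.Theory.
Local Open Scope ring_scope.

Set Implicit Arguments.
Unset Strict Implicit.
Unset Printing Implicit Defensive.

(** * Lagrange interpolation and Wilson's theorem *)

Lemma size_prod_XsubC_in (K : idomainType) (I : finType) (E : {set I}) (t : I -> K) :
  size (\prod_(z in E) ('X - (t z)%:P)) = #|E|.+1.
Proof. by rewrite -big_enum size_prod_XsubC cardE. Qed.

Lemma horner_prod_XsubC (K : comNzRingType) (I : finType) (E : {set I}) (t : I -> K) y :
  (\prod_(z in E) ('X - (t z)%:P)).[y] = \prod_(z in E) (y - t z).
Proof. by rewrite horner_prod; apply: eq_bigr => z _; rewrite hornerXsubC. Qed.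

Lemma lagrange_interpolation (K : fieldType) (I : finType) (E : {set I})
    (t v : I -> K) : {in E &, injective t} ->
  exists g : {poly K}, [/\ (size g <= #|E|)%N, {in E, forall y, g.[t y] = v y} &
    g`_#|E|.-1 = \sum_(y in E) v y / \prod_(z in E :\ y) (t y - t z)].
Proof.
move=> t_inj.
have cardD y : y \in E -> #|E :\ y|.+1 = #|E| by move=> yE; rewrite [RHS](cardsD1 y) yE.
exists (\sum_(y in E) (v y / \prod_(z in E :\ y) (t y - t z)) *:
          \prod_(z in E :\ y) ('X - (t z)%:P)); split.
- apply: leq_trans (size_sum _ _ _) _; apply/bigmax_leqP => y yE.
  by rewrite (leq_trans (size_scale_leq _ _)) // size_prod_XsubC_in cardD.
- move=> y yE; rewrite horner_sum (big_setD1 y) //= [X in _ + X]big1 ?addr0.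
    rewrite hornerZ horner_prod_XsubC.
    rewrite divfK //; apply/prodf_neq0 => z; rewrite 2!inE => /andP[zy zE].
    by rewrite subr_eq0; apply: contra zy => /eqP/t_inj ->.
  move=> x; rewrite 2!inE => /andP[xy xE].
  rewrite hornerZ horner_prod_XsubC [X in _ * X](big_setD1 y) /=; last by rewrite 2!inE eq_sym xy.
  by rewrite subrr mul0r mulr0.
- rewrite coef_sum; apply: eq_bigr => y yE; rewrite coefZ.
  have /monicP := monic_prod_XsubC (enum (E :\ y)) xpredT t.
  rewrite lead_coefE size_prod_XsubC big_enum -cardE /= => c1.
  by rewrite -(cardD y yE) /= c1 mulr1.
Qed.

Lemma lagrange_lead_coef (K : fieldType) (I : finType) (E : {set I})
    (t : I -> K) (h : {poly K}) : {in E &, injective t} -> (size h <= #|E|)%N ->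
  \sum_(y in E) h.[t y] / \prod_(z in E :\ y) (t y - t z) = h`_#|E|.-1.
Proof.
move=> t_inj size_h.
have [g [size_g gE <-]] := lagrange_interpolation (fun y => h.[t y]) t_inj.
suff /eqP : g - h = 0 by rewrite subr_eq0 => /eqP ->.
apply: (@roots_geq_poly_eq0 _ _ [seq t y | y <- enum E]).
- apply/allP => _ /mapP[y yE ->]; rewrite mem_enum in yE.
  by rewrite rootE hornerD hornerN gE // subrr.
- rewrite map_inj_in_uniq ?enum_uniq // => x y.
  by rewrite !mem_enum; apply: t_inj.
- by rewrite size_map -cardE (leq_trans (size_polyD _ _)) // size_polyN geq_max size_g.
Qed.

Lemma prod_sub_neq0 (K : idomainType) (I : finType) (E : {set I}) (t : I -> K) y :
  {in E, forall z, t z != y} -> \prod_(z in E) (y - t z) != 0.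
Proof. by move=> tE; apply/prodf_neq0 => z /tE; rewrite subr_eq0 eq_sym. Qed.

(** Wilson's theorem: differentiate ['X^q - 'X = \prod_z ('X - z)] at [y]; q = #|F| is 0 in F. *)
Lemma prod_sub_all (F : finFieldType) (y : F) : \prod_(z in [set~ y]) (y - z) = -1.
Proof.
have cardF0 : #|F|%:R = 0 :> F.
  have := erefl (\sum_(x : F) x); rewrite {1}(reindex_inj (addrI 1)).
  rewrite big_split sumr_const -[RHS]add0r /=.
  by move/addIr.
have := congr1 (fun P => P^`().[y]) (finField_genPoly F).
rewrite derivB derivXn derivX -scaler_nat cardF0 scale0r !hornerE.
rewrite (bigD1 y) //= derivM derivXsubC mul1r !hornerE subrr mul0r addr0 => ->.
rewrite horner_prod; apply: eq_big => [z|z _]; first by rewrite !inE.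
by rewrite hornerXsubC.
Qed.

(** * Divided differences *)

Section DividedDifference.
Variable F : finFieldType.
Implicit Types (f : F -> F) (C D E G : {set F}).

(** By Lagrange's formula, the coefficient of degree [#|C| - 1] in the interpolant of [f] on [C]. *)
Definition ddiff f C : F := \sum_(c in C) f c / \prod_(d in C :\ c) (c - d).

Lemma prod_setU1D1 (g : F -> F) C c y : c \in C -> y \notin C ->
  \prod_(d in (y |: C) :\ c) g d = g y * \prod_(d in C :\ c) g d.
Proof.
move=> cC yC; have yc : y != c by apply: contraNneq yC => ->.
have -> : (y |: C) :\ c = y |: (C :\ c).
  by apply/setP => x; rewrite !inE; case: (x =P y) => [->|//]; rewrite yc.
by rewrite big_setU1 // !inE yc.
Qed.

(** At each c in [C] this is 1 / (c - y) - 1 / (c - z) = (y - z) / ((c - y) (c - z)). *)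
Lemma ddiff_sub f C y z : y \notin C -> z \notin C -> y != z ->
  ddiff f (y |: C) - ddiff f (z |: C) = (y - z) * ddiff f (z |: (y |: C)).
Proof.
move=> yC zC yz.
have yz0 : y - z != 0 by rewrite subr_eq0.
have zy0 : z - y != 0 by rewrite subr_eq0 eq_sym.
have zyC : z \notin y |: C by rewrite !inE eq_sym (negPf yz).
have prod0 x : x \notin C -> \prod_(d in C) (x - d) != 0.
  by move=> xC; apply: (prod_sub_neq0 (t := id)) => d dC; apply: contraNneq xC => <-.
rewrite /ddiff !big_setU1 //= !setU1K //.
have -> : (z |: (y |: C)) :\ y = z |: C.
  by rewrite setUCA setU1K // !inE (negPf yz).
rewrite ![\prod_(d in _ |: _) _]big_setU1 //=.
set A := \sum_(c in C) _; set B := \sum_(c in C) _; set S := \sum_(c in C) _.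
have ABS : A - B = (y - z) * S.
  rewrite mulr_sumr -sumrB; apply: eq_bigr => c cC.
  have cyC : c \in y |: C by rewrite !inE cC orbT.
  rewrite (prod_setU1D1 _ cyC zyC).
  rewrite !prod_setU1D1 //.
  have cy : c - y != 0 by rewrite subr_eq0; apply: contraNneq yC => <-.
  have cz : c - z != 0 by rewrite subr_eq0; apply: contraNneq zC => <-.
  have c0 : \prod_(d in C :\ c) (c - d) != 0.
    apply: (prod_sub_neq0 (t := id)) => d; rewrite !inE; by case/andP.
  by field; rewrite c0 cy cz.
have -> : A = B + (y - z) * S by rewrite -ABS addrC subrK.
by field; rewrite !prod0 //= yz0 zy0.
Qed.

End DividedDifference.

(** * Segre's tangents *)

Section TangentPolynomial.
Variables (F : finFieldType) (f : F -> F) (n : nat).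
Hypothesis ddiff_n1 : forall C : {set F}, #|C| = n.+1 -> ddiff f C != 0.
Hypothesis ddiff_n2 : forall C : {set F}, #|C| = n.+2 -> ddiff f C != 0.
Implicit Types (C D E G : {set F}).

Lemma ddiff_inj D : #|D| = n -> {in ~: D &, injective (fun y => ddiff f (y |: D))}.
Proof.
move=> Dn y z; rewrite !inE => yD zD eq_yz; apply/eqP/negPn/negP => yz.
have := ddiff_sub f yD zD yz; rewrite eq_yz subrr => /esym/eqP.
apply/negP; rewrite mulf_neq0 ?subr_eq0 // ddiff_n2 //.
by rewrite !cardsU1 !inE negb_or eq_sym yz zD yD Dn.
Qed.

(* The interpolants of f at D are parametrised by m; the roots m of this
   polynomial are those that agree with f nowhere outside D, the value 0 being
   taken at infinity. *)
Definition tangent_poly D : {poly F} :=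
  \prod_(m in ~: (0 |: [set ddiff f (y |: D) | y in ~: D])) ('X - m%:P).

(** The q - n values [ddiff f (y |: D)] are distinct and nonzero; with 0 they leave n - 1 roots. *)
Lemma size_tangent_poly D : #|D| = n -> (0 < n)%N -> size (tangent_poly D) = n.
Proof.
move=> Dn n_gt0; rewrite size_prod_XsubC_in cardsCs setCK cardsU1.
rewrite card_in_imset; last exact: ddiff_inj.
have -> : 0 \notin [set ddiff f (y |: D) | y in ~: D].
  apply/imsetP => -[y]; rewrite inE => yD /esym/eqP.
  by apply/negP/ddiff_n1; rewrite cardsU1 yD Dn.
rewrite cardsCs setCK Dn.
have := max_card (mem D); rewrite Dn => nq.
by move: n_gt0 nq; set q := #|_|; lia.
Qed.

Lemma monic_tangent_poly D : tangent_poly D \is monic.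
Proof. by rewrite /tangent_poly -big_enum monic_prod_XsubC. Qed.

(* Segre's lemma of tangents: up to the explicit factor, the value depends on
   y and D through the union of D and y only. *)
Lemma tangent_polyE D y (C := y |: D) : #|D| = n -> y \notin D ->
  (tangent_poly D).[ddiff f C] =
  \prod_(d in D) (y - d) / (ddiff f C * \prod_(z in ~: C) ddiff f (z |: C)).
Proof.
move=> Dn yD; set g := fun y => ddiff f (y |: D).
have cardC : #|C| = n.+1 by rewrite cardsU1 yD Dn.
have im_g z : z \notin D -> g z \in [set ddiff f (y |: D) | y in ~: D].
  by move=> zD; apply: imset_f; rewrite inE.
have eqC : ~: D :\ y = ~: C by apply/setP => x; rewrite !inE negb_or.
(* Wilson's theorem at [ddiff f C]: the other elements of F are the tangents, 0 and the [g z] with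
   [z] outside [C]. *)
have tan : (tangent_poly D).[ddiff f C] *
    (ddiff f C * \prod_(z in ~: C) (g y - g z)) = -1.
  rewrite horner_prod_XsubC -(prod_sub_all (ddiff f C)).
  rewrite [RHS](big_setID (0 |: [set ddiff f (y |: D) | y in ~: D])) /= mulrC.
  congr (_ * _).
    transitivity (\prod_(z in 0 |: [set g z | z in ~: C]) (ddiff f C - z)).
      rewrite big_setU1 /=; last first.
        apply/imsetP => -[z]; rewrite !inE negb_or => /andP[_ zD] /esym/eqP.
        by apply/negP/ddiff_n1; rewrite cardsU1 zD Dn.
      rewrite subr0 big_imset //= => u v.
      by rewrite -eqC => /setD1P[_ uD] /setD1P[_ vD]; apply: ddiff_inj.
    apply: eq_bigl => m; rewrite !inE; apply/idP/idP.
      case/orP => [/eqP->|/imsetP[z zC ->]].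
        by rewrite eqxx eq_sym ddiff_n1.
      move: zC; rewrite -eqC => /setD1P[zy zD].
      rewrite inE in zD; rewrite im_g // orbT andbT.
      by apply: contra zy => /eqP/ddiff_inj -> //; rewrite inE.
    case/andP => mC /orP[->//|/imsetP[z zD mE]]; apply/orP; right.
    apply/imsetP; exists z => //; rewrite -eqC !inE; rewrite inE in zD.
    by rewrite zD andbT; apply: contra mC => /eqP zy; rewrite mE zy.
  apply: eq_bigl => m; rewrite !inE; case: (m =P ddiff f C) => [->|].
    by rewrite andbF -[ddiff f C]/(g y) im_g ?orbT.
  by rewrite andbT.
have wil : \prod_(d in D) (y - d) * \prod_(z in ~: C) (y - z) = -1.
  rewrite -(prod_sub_all y) [RHS](big_setID D) /=; congr (_ * _); apply: eq_bigl => z.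
    by rewrite !inE; case: (z =P y) => [->|]; rewrite ?(negPf yD) ?andbT.
  by rewrite !inE negb_or andbC.
have sub : \prod_(z in ~: C) (g y - g z) =
    \prod_(z in ~: C) (y - z) * \prod_(z in ~: C) ddiff f (z |: C).
  rewrite -big_split; apply: eq_bigr => z; rewrite -eqC !inE => /andP[zy zD] /=.
  by rewrite /g ddiff_sub // eq_sym.
have gam0 : ddiff f C * \prod_(z in ~: C) ddiff f (z |: C) != 0.
  rewrite mulf_neq0 ?ddiff_n1 //; apply/prodf_neq0 => z zC.
  by rewrite ddiff_n2 // cardsU1 cardC; move: zC; rewrite inE => ->.
have yz0 : \prod_(z in ~: C) (y - z) != 0.
  apply: (prod_sub_neq0 (t := id)) => z; rewrite !inE negb_or; by case/andP.
apply: (canRL (mulfK gam0)); apply: (mulIf yz0).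
by rewrite wil -tan sub; ring.
Qed.

Definition cross D E : F := \prod_(d in D) \prod_(e in E) (e - d).

Lemma cross_neq0 D E : [disjoint D & E] -> cross D E != 0.
Proof.
move=> DE; apply/prodf_neq0 => d dD; apply/prodf_neq0 => e eE.
by rewrite subr_eq0; apply: contraTneq dD => <-; rewrite (disjointFl DE).
Qed.

Lemma cross_setU1l D E y : y \notin D ->
  cross (y |: D) E = \prod_(e in E) (e - y) * cross D E.
Proof. by move=> yD; rewrite /cross big_setU1. Qed.

Lemma cross_setU1r D E y : y \notin E ->
  cross D (y |: E) = \prod_(d in D) (y - d) * cross D E.
Proof.
move=> yE; rewrite /cross -big_split; apply: eq_bigr => d _.
by rewrite big_setU1.
Qed.

(** The tangent polynomial is monic of degree n - 1, so Lagrange's formula at the n nodes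
    [ddiff f (y |: D)] sums to 1. *)
Lemma cross_lift G : (0 < n)%N -> #|G| = n.*2 -> exists V : {set F} -> F,
  forall D, D \subset G -> #|D| = n ->
    \sum_(y in G :\: D) V (y |: D) = (cross D (G :\: D))^-1.
Proof.
move=> n_gt0 cardG.
(* Dividing the term of [y] in Lagrange's formula by [cross D (G :\: D)] cancels
   [\prod_(d in D) (y - d)]; what is left depends only on [C = y |: D]. *)
exists (fun C => (-1) ^+ n.-1 /
  (ddiff f C * \prod_(z in ~: C) ddiff f (z |: C) *
   \prod_(z in G :\: C) ddiff f (z |: C) * cross C (G :\: C))) => D DG Dn.
set E := G :\: D.
have cardE : #|E| = n by rewrite cardsD (setIidPr DG) cardG Dn -addnn addKn.
have Einj : {in E &, injective (fun y => ddiff f (y |: D))}.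
  by move=> y z /setDP[_ yD] /setDP[_ zD]; apply: ddiff_inj; rewrite ?inE.
have size_h : (size (tangent_poly D) <= #|E|)%N.
  by rewrite cardE size_tangent_poly.
have := lagrange_lead_coef Einj size_h.
rewrite cardE -{1}(size_tangent_poly Dn n_gt0) -lead_coefE.
rewrite (monicP (monic_tangent_poly D)) => sumE.
rewrite -[RHS]mulr1 -[X in _ = _ * X]sumE mulr_sumr; apply: eq_bigr => y yE.
have /setDP[yG yD] := yE.
have eqE : G :\: (y |: D) = E :\ y by rewrite setUC setDDl.
have yEy : y \notin E :\ y by rewrite !inE eqxx.
rewrite tangent_polyE // eqE cross_setU1l //.
rewrite -[in cross D E](setD1K yE) cross_setU1r //.
have -> : \prod_(z in E :\ y) (ddiff f (y |: D) - ddiff f (z |: D)) =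
    (-1) ^+ n.-1 * \prod_(z in E :\ y) (z - y) *
      \prod_(z in E :\ y) ddiff f (z |: (y |: D)).
  have -> : n.-1 = #|E :\ y| by rewrite -cardE (cardsD1 y E) yE.
  rewrite -prodrN -big_split; apply: eq_bigr => z /setD1P[zy /setDP[zG zD]] /=.
  by rewrite ddiff_sub // 1?eq_sym // opprB.
set s := (-1) ^+ _.
have s2 : s * s = 1 by rewrite -expr2 sqrr_sign.
have s0 : s != 0 by rewrite signr_eq0.
have cardC : #|y |: D| = n.+1 by rewrite cardsU1 yD Dn.
have dd0 : ddiff f (y |: D) != 0 by rewrite ddiff_n1.
have dz0 z : z \notin y |: D -> ddiff f (z |: (y |: D)) != 0.
  by move=> zC; rewrite ddiff_n2 // cardsU1 zC cardC.
have p1 : \prod_(z in ~: (y |: D)) ddiff f (z |: (y |: D)) != 0.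
  by apply/prodf_neq0 => z zC; rewrite dz0 //; move: zC; rewrite inE.
have p2 : \prod_(z in E :\ y) ddiff f (z |: (y |: D)) != 0.
  apply/prodf_neq0 => z; rewrite -eqE => /setDP[_ zC]; exact: dz0.
have p3 : \prod_(z in E :\ y) (z - y) != 0.
  by apply/prodf_neq0 => z /setD1P[zy _]; rewrite subr_eq0.
have p4 : \prod_(d in D) (y - d) != 0.
  apply: (prod_sub_neq0 (t := id)) => d dD; by apply: contraNneq yD => <-.
have p5 : cross D (E :\ y) != 0.
  apply: cross_neq0; rewrite disjoints_subset; apply/subsetP => x xD.
  by rewrite !inE xD /= andbF.
have sV : s = s^-1 by apply: (mulIf s0); rewrite s2 mulVf.
rewrite {1}sV.
by field; rewrite p1 p2 p3 p4 p5 s0 dd0.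
Qed.

End TangentPolynomial.

(** * Contradiction by inclusion-exclusion *)

Lemma exists_subset (T : finType) (G : {set T}) n : (n <= #|G|)%N ->
  exists2 D : {set T}, D \subset G & #|D| = n.
Proof.
move=> nG; exists [set x in take n (enum G)].
  by apply/subsetP => x; rewrite inE => /mem_take; rewrite mem_enum.
rewrite cardsE; move/card_uniqP: (take_uniq n (enum_uniq (mem G))) => ->.
by rewrite size_takel // -cardE.
Qed.

Section SmallDimension.
Variables (F : finFieldType) (n : nat) (G : {set F}) (V : {set F} -> F).
Hypotheses (n_gt0 : (0 < n)%N) (cardG : #|G| = n.*2).
Hypothesis V_lift : forall D : {set F}, D \subset G -> #|D| = n ->
  \sum_(y in G :\: D) V (y |: D) = (cross D (G :\: D))^-1.
Hypothesis natr_neq0 : forall m, (1 < m <= n.+1)%N -> m%:R != 0 :> F.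
Implicit Types (A B C D : {set F}).

Let S A B : F := \sum_(C : {set F} | [&& A \subset C, C \subset G :\: B & #|C| == n.+1]) V C.

(** Double counting: [C] arises from each of its n + 1 - #|A| points outside [A]. *)
Lemma sum_supersets A : A \subset G -> (#|A| <= n.+1)%N ->
  (n.+1 - #|A|)%:R * S A set0 = \sum_(x in G :\: A) S (x |: A) set0.
Proof.
move=> AG leA; rewrite /S setD0.
rewrite [RHS](exchange_big_dep
  (fun C : {set F} => [&& A \subset C, C \subset G & #|C| == n.+1])) /=; last first.
  by move=> x C _; rewrite subUset => /andP[/andP[_ ->] ->].
rewrite mulr_sumr; apply: eq_bigr => C /and3P[AC CG /eqP cardC].
rewrite (eq_bigl (fun x => x \in C :\: A)) => [|x].
  by rewrite sumr_const cardsD (setIidPr AC) cardC mulr_natl.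
rewrite subUset AC CG cardC eqxx sub1set !andbT !inE -andbA; congr (_ && _).
by case xC: (x \in C); rewrite ?andbF // (subsetP CG _ xC).
Qed.

(** Up to a common factor, this is Lagrange's formula on n + 1 points for [\prod_(d in A) ('X - d)],
    whose coefficient of degree n is 0. *)
Lemma sum_cross_inv A : A \subset G -> #|A| = n.-1 ->
  \sum_(x in G :\: A) (cross (x |: A) (G :\: (x |: A)))^-1 = 0.
Proof.
move=> AG cardA; set R := G :\: A.
have cardR : #|R| = n.+1.
  by rewrite cardsD (setIidPr AG) cardG cardA -addnn; lia.
pose h := \prod_(d in A) ('X - d%:P).
have size_h : size h = n by rewrite size_prod_XsubC_in cardA prednK.
have size_hR : (size h <= #|R|)%N by rewrite size_h cardR.
have id_inj : {in R &, injective (@id F)} by [].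
have := lagrange_lead_coef id_inj size_hR.
rewrite cardR /= nth_default ?size_h // => sum0.
transitivity ((-1) ^+ n / cross A R *
  \sum_(x in R) h.[x] / \prod_(z in R :\ x) (x - z)); last by rewrite sum0 mulr0.
rewrite mulr_sumr; apply: eq_bigr => x xR; have /setDP[xG xA] := xR.
have eqR : G :\: (x |: A) = R :\ x by rewrite setUC setDDl.
rewrite eqR cross_setU1l // -[in cross A R](setD1K xR) cross_setU1r ?inE ?eqxx //.
rewrite horner_prod_XsubC.
have -> : \prod_(e in R :\ x) (e - x) = (-1) ^+ n * \prod_(e in R :\ x) (x - e).
  have <- : #|R :\ x| = n by apply/eqP; rewrite -eqSS -cardR (cardsD1 x R) xR.
  by rewrite -prodrN; apply: eq_bigr => e _; rewrite opprB.
set s := (-1) ^+ _.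
have s0 : s != 0 by rewrite signr_eq0.
have sV : s = s^-1 by apply: (mulIf s0); rewrite mulVf // -expr2 sqrr_sign.
have c0 : cross A (R :\ x) != 0.
  apply: cross_neq0; rewrite disjoints_subset; apply/subsetP => y yA.
  by rewrite !inE yA /= andbF.
have p0 : \prod_(e in R :\ x) (x - e) != 0.
  by apply: (prod_sub_neq0 (t := id)) => e /setD1P[].
have q0 : \prod_(d in A) (x - d) != 0.
  by apply: (prod_sub_neq0 (t := id)) => d dA; apply: contraNneq xA => <-.
by rewrite [s in RHS]sV; field; rewrite c0 p0 q0 s0.
Qed.

(** Induction downwards from #|A| = n - 1, where [V_lift] and [sum_cross_inv] apply; the divisors n
    + 1 - #|A| lie between 2 and n + 1. *)
Lemma sum_supersets_eq0 j A : A \subset G -> (#|A| + j)%N = n.-1 -> S A set0 = 0.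
Proof.
elim: j A => [|j IHj] A AG cardA.
  rewrite addn0 in cardA.
  have : (n.+1 - #|A|)%:R * S A set0 = 0.
    rewrite sum_supersets //; last by rewrite cardA; lia.
    apply: etrans (sum_cross_inv AG cardA); apply: eq_bigr => x /setDP[xG xA].
    have DG : x |: A \subset G by rewrite subUset sub1set xG AG.
    have cardD : #|x |: A| = n by rewrite cardsU1 xA cardA; lia.
    rewrite -V_lift //.
    have := sum_supersets DG; rewrite cardD subSnn mul1r => -> //.
    apply: eq_bigr => y /setDP[yG yD].
    have cardC : #|y |: (x |: A)| = n.+1 by rewrite cardsU1 yD cardD.
    rewrite /S (big_pred1 (y |: (x |: A))) // => C; rewrite setD0 /=.
    apply/idP/eqP => [/and3P[yC _ cardC']|->]; last first.
      by rewrite subxx subUset sub1set yG DG cardC eqxx.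
    by apply/esym/eqP; rewrite eqEcard yC (eqP cardC') cardC /=.
  by move/eqP; rewrite mulf_eq0 (negPf (natr_neq0 _)) => [/eqP|]; rewrite ?cardA //; lia.
have : (n.+1 - #|A|)%:R * S A set0 = 0.
  rewrite sum_supersets //; last by lia.
  apply: big1 => x /setDP[xG xA]; apply: IHj.
    by rewrite subUset sub1set xG AG.
  by rewrite cardsU1 xA; lia.
by move/eqP; rewrite mulf_eq0 (negPf (natr_neq0 _)) => [/eqP|]; rewrite ?cardA //; lia.
Qed.

(** Inclusion-exclusion: the sets that avoid [B :\ y] contain [y] or avoid [B]. *)
Lemma sum_avoiding_eq0 B A : A \subset G -> B \subset G -> [disjoint A & B] ->
  (#|A| + #|B| <= n.-1)%N -> S A B = 0.
Proof.
move: {2}#|B| (erefl #|B|) => b; elim: b A B => [|b IHb] A B cardB AG BG AB leAB.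
  have /eqP-> : B == set0 by rewrite -cards_eq0 cardB.
  by apply: (@sum_supersets_eq0 (n.-1 - #|A|)%N) => //; lia.
have /card_gt0P[y yB] : (0 < #|B|)%N by rewrite cardB.
have cardB' : #|B :\ y| = b by move: cardB; rewrite (cardsD1 y B) yB => -[].
have yA : y \notin A by rewrite (disjointFl AB).
have B'G : B :\ y \subset G by rewrite (subset_trans (subD1set _ _)).
have AB' : [disjoint A & B :\ y].
  by rewrite (disjointWr _ AB) // subD1set.
have yAB' : [disjoint y |: A & B :\ y].
  rewrite disjoints_subset subUset sub1set !inE eqxx /=.
  by rewrite -disjoints_subset.
have : S A (B :\ y) = 0 by apply: IHb => //; lia.
rewrite /S (bigID (fun C : {set F} => y \in C)) /=.
have := IHb (y |: A) (B :\ y) cardB'; rewrite /S => IH.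
rewrite [X in X + _](_ : _ = 0) ?add0r => [|].
  move=> S0; apply: etrans S0; apply: eq_bigl => C; rewrite -andbA; congr (_ && _).
  rewrite -andbA [_ && (y \notin C)]andbC andbA; congr (_ && _).
  apply/subsetP/andP => [sub|[/subsetP sub yC] x xC].
    split; last by apply/negP => /sub; rewrite inE yB.
    by apply/subsetP => x /sub; rewrite !inE => /andP[/negPf-> ->]; rewrite andbF.
  have := sub _ xC; rewrite !inE negb_and negbK => /andP[+ ->].
  by case/orP => [/eqP xy|->//]; rewrite -xy xC in yC.
rewrite -[RHS]IH //; first last.
- by rewrite cardsU1 yA; lia.
- by rewrite subUset sub1set (subsetP BG) ?AG.
apply: eq_bigl => C; rewrite subUset sub1set.
by case: (y \in C); rewrite ?andbF ?andbT.
Qed.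

(** [V C] is the sum over the sets avoiding the n - 1 points of [G :\: C], so it is 0, but the
    right-hand side of [V_lift] is not. *)
Lemma cross_not_lifted_small : False.
Proof.
have V0 C : C \subset G -> #|C| = n.+1 -> V C = 0.
  move=> CG cardC; rewrite -(@sum_avoiding_eq0 (G :\: C) set0) ?sub0set ?subsetDl //.
  - rewrite /S (big_pred1 C) // => C' /=.
    rewrite sub0set setDDr setDv set0U (setIidPr CG) /=.
    apply/andP/eqP => [[C'C cardC']|->]; last by rewrite subxx cardC eqxx.
    by apply/eqP; rewrite eqEcard C'C cardC (eqP cardC') /=.
  - by rewrite disjoints_subset sub0set.
  - by rewrite cards0 cardsD (setIidPr CG) cardG cardC -addnn; lia.
have [D DG cardD] : exists2 D : {set F}, D \subset G & #|D| = n.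
  by apply: exists_subset; rewrite cardG -addnn leq_addr.
have := V_lift DG cardD; rewrite big1 => [/esym/eqP|y /setDP[yG yD]].
  rewrite invr_eq0 (negPf (cross_neq0 _)) //.
  by rewrite disjoints_subset; apply/subsetP => x xD; rewrite !inE xD.
apply: V0; first by rewrite subUset sub1set yG DG.
by rewrite cardsU1 yD cardD.
Qed.

End SmallDimension.

(** * Alternating sums over the choices from a pairing *)

Lemma big_set_in (R : Type) (idx : R) (op : Monoid.com_law idx) (T : finType)
    (s : seq T) (g : T -> R) : uniq s ->
  \big[op/idx]_(y in [set x in s]) g y = \big[op/idx]_(y <- s) g y.
Proof. by move=> us; rewrite big_uniq //; apply: eq_bigl => y; rewrite inE. Qed.

Section Swaps.
Variable K : fieldType.
Implicit Types (p r : K * K) (L l : seq (K * K)).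

(* In an element l of swaps L the first components of l select one member of
   each pair of L, the second components are the remaining ones. *)
Fixpoint swaps L : seq (seq (K * K)) :=
  if L is p :: L' then
    [seq p :: l | l <- swaps L'] ++ [seq (p.2, p.1) :: l | l <- swaps L']
  else [:: [::]].

Definition points L := unzip1 L ++ unzip2 L.

Lemma big_swaps_cons p L (g : seq (K * K) -> K) :
  \sum_(l <- swaps (p :: L)) g l =
  \sum_(l <- swaps L) (g (p :: l) + g ((p.2, p.1) :: l)).
Proof. by rewrite big_cat !big_map big_split. Qed.

Lemma perm_points_cons p L : perm_eq (points (p :: L)) [:: p.1, p.2 & points L].
Proof. by rewrite /points /= perm_cons -cat1s perm_catCA. Qed.

Lemma perm_swaps L l : l \in swaps L -> perm_eq (points l) (points L).
Proof.
elim: L l => [|p L IHL] l /=; first by rewrite inE => /eqP->.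
rewrite mem_cat => /orP[] /mapP[l' /IHL eql ->];
  apply: perm_trans (perm_points_cons _ _) _;
  rewrite perm_sym; apply: perm_trans (perm_points_cons _ _) _.
  by rewrite !perm_cons perm_sym.
by rewrite /= -[X in perm_eq X]/([:: p.1] ++ [:: p.2] ++ _) perm_catCA /= !perm_cons perm_sym.
Qed.

Lemma size_swaps L l : l \in swaps L -> size l = size L.
Proof.
move/perm_swaps/perm_size; rewrite !size_cat !size_map !addnn.
exact: double_inj.
Qed.

Definition pair_cross p l : K := \prod_(r <- l) ((p.2 - r.1) * (r.2 - p.1)).

(** The inverse of the product of all [r.2 - p.1] without the diagonal factors p = r. *)
Fixpoint kern l : K := if l is p :: l' then kern l' / pair_cross p l' else 1.

(** Swapping a pair reverses the sign, so this weight makes sums over [swaps] alternate. *)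
Definition gaps l : K := \prod_(p <- l) (p.2 - p.1).

Lemma gaps_kern l : uniq (points l) ->
  gaps l / (\prod_(p <- l) \prod_(r <- l) (r.2 - p.1)) = kern l.
Proof.
rewrite /gaps; elim: l => [|p l IHl]; first by rewrite !big_nil divr1.
rewrite (perm_uniq (perm_points_cons _ _)) /= inE negb_or -andbA.
case/and4P => p12 p1l p2l ul; rewrite -IHl // !big_cons /=.
under [X in _ / (_ * X)]eq_bigr => r _ do rewrite big_cons.
have p0 : p.2 - p.1 != 0 by rewrite subr_eq0 eq_sym.
have q0 : pair_cross p l != 0.
  rewrite /pair_cross prodf_seq_neq0; apply/allP => r rl /=.
  rewrite mulf_neq0 // subr_eq0.
    by apply: contraNneq p2l => ->; rewrite mem_cat map_f.
  by apply: contraNneq p1l => <-; rewrite mem_cat map_f ?orbT.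
have c0 : \prod_(p <- l) \prod_(r <- l) (r.2 - p.1) != 0.
  rewrite prodf_seq_neq0; apply/allP => x xl /=.
  rewrite prodf_seq_neq0; apply/allP => y yl /=; rewrite subr_eq0.
  move: ul; rewrite cat_uniq => /and3P[_ + _]; apply: contraNneq => xy.
  by apply/hasP; exists y.2; rewrite ?map_f //= xy map_f.
rewrite big_split /= -/(pair_cross p l).
have -> : pair_cross p l = \prod_(r <- l) (p.2 - r.1) * \prod_(r <- l) (r.2 - p.1).
  by rewrite -big_split.
move: q0; rewrite /pair_cross big_split mulf_eq0 negb_or => /andP[q1 q2].
by field; rewrite p0 q1 q2 c0.
Qed.

End Swaps.

(* Swapping the pair r of l changes the sign of gaps l but not the argument of V. *)
Lemma sum_gaps_eq0 (F : finFieldType) (V : {set F} -> F) L (S : {set F}) :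
  \sum_(l <- swaps L) gaps l *
    \sum_(r <- l) V (r.2 |: ([set x in unzip1 l] :|: S)) = 0.
Proof.
elim: L S => [|p L IHL] S; first by rewrite big_seq1 big_nil mulr0.
rewrite big_swaps_cons.
(* The term of [p] itself involves both members of the pair and cancels; in the others the chosen
   member joins the fixed set [S]. *)
rewrite (eq_bigr (fun l =>
  (p.2 - p.1) * (gaps l * \sum_(r <- l) V (r.2 |: ([set x in unzip1 l] :|: (p.1 |: S)))) -
  (p.2 - p.1) * (gaps l * \sum_(r <- l) V (r.2 |: ([set x in unzip1 l] :|: (p.2 |: S)))))).
  by rewrite sumrB -!mulr_sumr !IHL mulr0 subrr.
move=> l _; rewrite /gaps !big_cons /= !set_cons.
have cons_setU x : (x |: [set y in unzip1 l]) :|: S = [set y in unzip1 l] :|: (x |: S).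
  by rewrite -setUA setUCA.
rewrite !cons_setU [p.1 |: ([set y in _] :|: _)]setUCA [p.2 |: ([set y in _] :|: _)]setUCA.
rewrite [p.1 |: (p.2 |: S)]setUCA.
by ring.
Qed.

(** [V_lift], at the first components of [l], turns the summands of [sum_gaps_eq0] into [kern l]. *)
Lemma sum_kern_eq0 (F : finFieldType) (V : {set F} -> F) L :
  uniq (points L) ->
  (forall D : {set F}, D \subset [set x in points L] -> #|D| = size L ->
    \sum_(y in [set x in points L] :\: D) V (y |: D) =
    (cross D ([set x in points L] :\: D))^-1) ->
  \sum_(l <- swaps L) kern l = 0.
Proof.
move=> uL V_lift; apply: etrans (sum_gaps_eq0 V L set0).
rewrite big_seq [RHS]big_seq; apply: eq_bigr => l lL.
have eqL := perm_swaps lL; have ul : uniq (points l) by rewrite (perm_uniq eqL).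
have [u1 u2 disj12] : [/\ uniq (unzip1 l), uniq (unzip2 l) & ~~ has (mem (unzip1 l)) (unzip2 l)].
  by move: ul; rewrite cat_uniq => /and3P[].
have eqG : [set x in points L] :\: [set x in unzip1 l] = [set x in unzip2 l].
  apply/setP => x; rewrite !inE -(perm_mem eqL) mem_cat.
  case x1: (x \in unzip1 l) => /=; last by [].
  by apply/esym/negP => x2; case/hasP: disj12; exists x.
have DG : [set x in unzip1 l] \subset [set x in points L].
  by apply/subsetP => x; rewrite !inE -(perm_mem eqL) mem_cat => ->.
have cardD : #|[set x in unzip1 l]| = size L.
  by rewrite cardsE (card_uniqP u1) size_map (size_swaps lL).
rewrite -gaps_kern // setU0; congr (_ * _).
have := V_lift _ DG cardD; rewrite eqG big_set_in // big_map => ->; congr (_^-1).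
rewrite /cross big_set_in // big_map; apply: eq_bigr => p _.
by rewrite big_set_in // big_map.
Qed.

(** * Descent on the number of pairs *)

Section KernelSum.
Variable F : finFieldType.
Implicit Types (a b d x : F) (L l : seq (F * F)).

Definition kern_sum L : F := \sum_(l <- swaps L) kern l.

(* Up to the factor (b - a2) (b - b2) \prod_(r <- L) (b - r.1) (b - r.2), the
   value at b is kern_sum [:: (a1, b), (a2, b2) & L]. *)
Definition kern_poly a1 a2 b2 L : {poly F} :=
  \sum_(l <- swaps L) kern l *:
   ((\prod_(r <- l) (r.2 - a1))^-1 *: ((\prod_(r <- l) ('X - (r.2)%:P)) *
      (((pair_cross (a2, b2) l)^-1 / (b2 - a1)) *: ('X - b2%:P) +
       ((pair_cross (b2, a2) l)^-1 / (a2 - a1)) *: ('X - a2%:P))) +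
    (\prod_(r <- l) (r.1 - a1))^-1 *: ((\prod_(r <- l) ('X - (r.1)%:P)) *
      (((pair_cross (a2, b2) l)^-1 / (a2 - a1)) *: ('X - a2%:P) +
       ((pair_cross (b2, a2) l)^-1 / (b2 - a1)) *: ('X - b2%:P)))).

Lemma size_kern_poly a1 a2 b2 L : (size (kern_poly a1 a2 b2 L) <= (size L).+2)%N.
Proof.
have size_lin c1 c2 x1 x2 : (size (c1 *: ('X - x1%:P) + c2 *: ('X - x2%:P) : {poly F})%R <= 2)%N.
  rewrite (leq_trans (size_polyD _ _)) // geq_max.
  by rewrite !(leq_trans (size_scale_leq _ _)) ?size_XsubC.
have size_term (c : F) l (g : F * F -> F) (P : {poly F}) : l \in swaps L -> (size P <= 2)%N ->
    (size (c *: (\prod_(r <- l) ('X - (g r)%:P) * P))%R <= (size L).+2)%N.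
  move=> lL P2; rewrite (leq_trans (size_scale_leq _ _)) //.
  rewrite (leq_trans (size_polyMleq _ _)) // size_prod_XsubC (size_swaps lL).
  by rewrite /= -addn2 leq_add2l.
rewrite /kern_poly big_seq (leq_trans (size_sum _ _ _)) //; apply/bigmax_leqP_seq => l _ lL.
rewrite (leq_trans (size_scale_leq _ _)) // (leq_trans (size_polyD _ _)) // geq_max.
by rewrite !size_term.
Qed.

Lemma prod_points_neq0 L l x (g : F * F -> F) : l \in swaps L -> x \notin points L ->
  {in l, forall r, g r \in points l} ->
  (\prod_(r <- l) (g r - x) != 0) * (\prod_(r <- l) (x - g r) != 0).
Proof.
move=> lL xL gl; have gx r : r \in l -> g r != x.
  by move/gl; rewrite (perm_mem (perm_swaps lL)); apply: contraTneq => ->.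
by split; rewrite prodf_seq_neq0; apply/allP => r /gx /=; rewrite subr_eq0 // eq_sym.
Qed.

Lemma mem_points1 l : {in l, forall r, r.1 \in points l}.
Proof. by move=> r rl; rewrite mem_cat map_f. Qed.

Lemma mem_points2 l : {in l, forall r, r.2 \in points l}.
Proof. by move=> r rl; rewrite mem_cat map_f ?orbT. Qed.

Lemma pair_crossE p l : pair_cross p l =
  \prod_(r <- l) (p.2 - r.1) * \prod_(r <- l) (r.2 - p.1).
Proof. exact: big_split. Qed.

Lemma prod_subC l (g : F * F -> F) x :
  \prod_(r <- l) (x - g r) = (-1) ^+ size l * \prod_(r <- l) (g r - x).
Proof.
elim: l => [|r l IHl]; first by rewrite !big_nil mulr1.
by rewrite !big_cons IHl exprS; ring.
Qed.

Lemma prod_Csub l (g : F * F -> F) x :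
  \prod_(r <- l) (g r - x) = (-1) ^+ size l * \prod_(r <- l) (x - g r).
Proof. by rewrite prod_subC mulrA -expr2 sqrr_sign mul1r. Qed.

Lemma signr_or m : (-1) ^+ m = 1 :> F \/ (-1) ^+ m = -1 :> F.
Proof. by rewrite -signr_odd; case: odd; [right|left]. Qed.

Lemma horner_prod_seq l (g : F * F -> F) x :
  (\prod_(r <- l) ('X - (g r)%:P)).[x] = \prod_(r <- l) (x - g r).
Proof. by rewrite horner_prod; apply: eq_bigr => r _; rewrite hornerXsubC. Qed.

(** The outer summands of [kern_poly] come from [(a1, b)] and [(b, a1)], the inner ones from
    [(a2, b2)] and [(b2, a2)]. *)
Lemma horner_kern_poly a1 a2 b2 L b : uniq [:: a1, a2, b2 & points L] ->
  b \notin [:: a1, a2, b2 & points L] ->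
  (kern_poly a1 a2 b2 L).[b] =
  (b - a2) * (b - b2) * (\prod_(r <- L) (b - r.1) * \prod_(r <- L) (b - r.2)) *
  kern_sum [:: (a1, b), (a2, b2) & L].
Proof.
rewrite /= !inE !negb_or -!andbA.
case/and4P=> a12 a1b2 a1L /and4P[a2b2 a2L b2L _] /and4P[ba1 ba2 bb2 bL].
have sub0 x y : x != y -> (x - y != 0) * (y - x != 0).
  by move=> xy; split; rewrite subr_eq0 // eq_sym.
rewrite /kern_poly horner_sum /kern_sum !big_swaps_cons mulr_sumr.
rewrite big_seq [RHS]big_seq; apply: eq_bigr => l lL.
have prodL : \prod_(r <- L) (b - r.1) * \prod_(r <- L) (b - r.2) =
    \prod_(r <- l) (b - r.1) * \prod_(r <- l) (b - r.2).
  transitivity (\prod_(x <- points L) (b - x)); first by rewrite big_cat !big_map.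
  by rewrite -(perm_big _ (perm_swaps lL)) big_cat !big_map.
rewrite prodL /= !pair_crossE !big_cons /=.
rewrite !(hornerXsubC, hornerD, hornerZ, hornerM, horner_prod_seq).
rewrite !(prod_subC _ _ a1) !(prod_Csub _ _ b).
have nz x g (xL : x \notin points L) (gl : {in l, forall r, g r \in points l}) :=
  prod_points_neq0 lL xL gl.
have dist := (sub0 _ _ a12, sub0 _ _ a1b2, sub0 _ _ a2b2, sub0 _ _ ba1, sub0 _ _ ba2, sub0 _ _ bb2).
have [-> | ->] := signr_or (size l); field;
  by rewrite ?oppr_eq0 ?oner_eq0 ?dist ?(nz _ _ _ (@mem_points1 l)) ?(nz _ _ _ (@mem_points2 l)).
Qed.

(** The terms with ['X - a2] drop out, and in the others [a2] cancels from the products over [l],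
    which merges the two pairs into [(a1, b2)]. *)
Lemma horner_kern_poly_a2 a1 a2 b2 L : uniq [:: a1, a2, b2 & points L] ->
  (kern_poly a1 a2 b2 L).[a2] =
  (-1) ^+ size L * (a2 - b2) / (b2 - a1) * kern_sum ((a1, b2) :: L).
Proof.
rewrite /= !inE !negb_or -!andbA.
case/and4P=> a12 a1b2 a1L /and4P[a2b2 a2L b2L _].
have sub0 x y : x != y -> (x - y != 0) * (y - x != 0).
  by move=> xy; split; rewrite subr_eq0 // eq_sym.
rewrite /kern_poly horner_sum /kern_sum big_swaps_cons mulr_sumr.
rewrite big_seq [RHS]big_seq; apply: eq_bigr => l lL.
rewrite /= !pair_crossE /=.
rewrite !(hornerXsubC, hornerD, hornerZ, hornerM, horner_prod_seq).
rewrite subrr -(size_swaps lL) !(prod_subC _ _ a1) !(prod_Csub _ _ a2).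
have nz x g (xL : x \notin points L) (gl : {in l, forall r, g r \in points l}) :=
  prod_points_neq0 lL xL gl.
have dist := (sub0 _ _ a12, sub0 _ _ a1b2, sub0 _ _ a2b2).
have [-> | ->] := signr_or (size l); field;
  by rewrite ?oppr_eq0 ?oner_eq0 ?dist ?(nz _ _ _ (@mem_points1 l)) ?(nz _ _ _ (@mem_points2 l)).
Qed.

(** [kern_poly] has size at most m + 2 and vanishes off the 2 m + 3 points of
    [[:: a1, a2, b2 & points L]], hence at m + 2 points or more. So it is zero, and in particular
    its value at [a2]. *)
Lemma kern_sum_descent m : (3 * m + 5 <= #|F|)%N ->
  (forall L, size L = m.+2 -> uniq (points L) -> kern_sum L = 0) ->
  forall L, size L = m.+1 -> uniq (points L) -> kern_sum L = 0.
Proof.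
move=> leF kern0 [//|[a1 b2] L] [sizeL] uL.
have size_pts M : size (points M) = (size M).*2.
  by rewrite size_cat !size_map addnn.
have [a2 a2L] : exists a2, a2 \notin points ((a1, b2) :: L).
  have /subsetPn[a2 _ a2L] : ~~ (F \subset points ((a1, b2) :: L)).
    apply/negP => /subset_leq_card; rewrite leqNgt => /negP; apply.
    rewrite (leq_ltn_trans (card_size _)) // size_pts /= sizeL -addnn.
    by apply: leq_trans leF; lia.
  by exists a2.
have ua : uniq [:: a1, a2, b2 & points L].
  have /perm_uniq : perm_eq [:: a1, a2, b2 & points L] (a2 :: points ((a1, b2) :: L)).
    rewrite -[X in perm_eq X]/([:: a1] ++ [:: a2] ++ _) perm_catCA /= perm_cons.
    by rewrite perm_sym perm_points_cons.
  by move->; rewrite cons_uniq a2L.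
have P0 : kern_poly a1 a2 b2 L = 0.
  apply: (@roots_geq_poly_eq0 _ _ (enum [predC [:: a1, a2, b2 & points L]])).
  - apply/allP => b; rewrite mem_enum => bT; rewrite rootE horner_kern_poly //.
    rewrite kern0 ?mulr0 //; first by rewrite /= sizeL.
    have eq2 := perm_points_cons (a2, b2) L.
    rewrite (perm_uniq (perm_points_cons _ _)) 2!cons_uniq inE !(perm_mem eq2) (perm_uniq eq2).
    move: ua bT; rewrite /= !inE !negb_or.
    by case/and3P=> /and3P[-> -> ->] -> -> /and4P[ba1 -> -> ->]; rewrite eq_sym ba1.
  - exact: enum_uniq.
  - rewrite -cardE (leq_trans (size_kern_poly _ _ _ _)) //.
    rewrite -(leq_add2l #|[:: a1, a2, b2 & points L]|) cardC (card_uniqP ua) /=.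
    by rewrite size_pts sizeL -addnn; apply: leq_trans leF; lia.
have := horner_kern_poly_a2 ua; rewrite P0 horner0 => /esym/eqP.
move: ua; rewrite /= !inE !negb_or -!andbA => /and4P[a12 a1b2 _ /and3P[a2b2 _ _]].
rewrite mulf_eq0 => /orP[|/eqP//].
by rewrite !mulf_eq0 invr_eq0 signr_eq0 !subr_eq0 (negPf a2b2) eq_sym (negPf a1b2).
Qed.

(** Descent ends at the pair [(0, 1)], whose two orientations both contribute 1, and 2 is not 0. *)
Lemma kern_sum_not_all_zero m : 2%:R != 0 :> F -> (3 * m + 2 <= #|F|)%N ->
  ~ (forall L, size L = m.+1 -> uniq (points L) -> kern_sum L = 0).
Proof.
move=> two_neq0; elim: m => [_ kern0|m IHm leF kern0]; last first.
  by apply: IHm; [lia | apply: kern_sum_descent => //; lia].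
have := kern0 [:: (0, 1)] erefl; rewrite /= inE eq_sym oner_eq0 => /(_ isT)/eqP.
rewrite /kern_sum /= !big_cons big_nil /= /pair_cross !big_nil divr1 addr0.
by apply/negP.
Qed.
End KernelSum.

(** * Products of distinct linear factors in the kernel of a functional *)

Section SeroussiRoth.
Variable F : finFieldType.
Hypothesis two_neq0 : 2%:R != 0 :> F.
Implicit Types (f : F -> F) (x y w a : F) (X Z : {set F}).

Definition annihilates f s : bool :=
  [forall g : {poly_s F}, \sum_x f x * (val g).[x] == 0].

Lemma annihilatesP f s : reflect
  (forall g : {poly F}, (size g <= s)%N -> \sum_x f x * g.[x] = 0) (annihilates f s).
Proof.
apply: (iffP forallP) => [ann g size_g|ann g]; last by rewrite ann // size_npoly.
by have /eqP := ann (NPoly size_g).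
Qed.

Lemma sum_XsubC_mul f a (g : {poly F}) :
  \sum_x f x * (x - a) * g.[x] = \sum_x f x * (('X - a%:P) * g).[x].
Proof. by apply: eq_bigr => x _; rewrite hornerM hornerXsubC mulrA. Qed.

Lemma annihilates_shift f s t a : annihilates f s -> (t < s)%N ->
  annihilates (fun x => f x * (x - a)) t.
Proof.
move=> /annihilatesP ann ts; apply/annihilatesP => g size_g.
rewrite sum_XsubC_mul ann // (leq_trans (size_polyMleq _ _)) // size_XsubC /=.
exact: leq_ltn_trans size_g ts.
Qed.

Lemma annihilatesS f a s : (0 < s)%N -> annihilates f s ->
  annihilates (fun x => f x * (x - a)) s -> annihilates f s.+1.
Proof.
move=> s_gt0 /annihilatesP annf /annihilatesP anna; apply/annihilatesP => g size_g.
have /factor_theorem[h eqg] : root (g - g.[a]%:P) a.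
  by rewrite rootE !hornerE subrr.
have eg : g = ('X - a%:P) * h + g.[a]%:P by rewrite mulrC -eqg subrK.
rewrite eg; under eq_bigr do rewrite hornerD mulrDr.
rewrite big_split /= -sum_XsubC_mul anna ?add0r.
  by rewrite annf // size_polyC; case: eqP => //=; lia.
have [->|h0] := eqVneq h 0; first by rewrite size_poly0.
have : (size (g - g.[a]%:P)%R <= s.+1)%N.
  rewrite (leq_trans (size_polyD _ _)) // size_polyN geq_max size_g size_polyC.
  by case: eqP => /=; lia.
by rewrite eqg size_Mmonic ?monicXsubC // size_XsubC addn2.
Qed.

Lemma annihilates_ext f1 f2 s : f1 =1 f2 -> annihilates f1 s = annihilates f2 s.
Proof.
by move=> ef; apply/annihilatesP/annihilatesP => ann g size_g;
  apply: etrans (ann g size_g); apply: eq_bigr => x _; rewrite ef.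
Qed.

Lemma annihilates_lin f1 f2 f3 c1 c2 s : annihilates f1 s -> annihilates f2 s ->
  (forall x, f3 x = c1 * f1 x + c2 * f2 x) -> annihilates f3 s.
Proof.
move=> /annihilatesP a1 /annihilatesP a2 e3; apply/annihilatesP => g size_g.
transitivity (c1 * (\sum_x f1 x * g.[x]) + c2 * (\sum_x f2 x * g.[x])).
  by rewrite !mulr_sumr -big_split; apply: eq_bigr => x _; rewrite e3 /=; ring.
by rewrite a1 // a2 // !mulr0 addr0.
Qed.

(** [(z - x) - (z - y)] is a nonzero constant. *)
Lemma annihilates_two f s x y : (0 < s)%N -> x != y ->
  annihilates (fun z => f z * (z - x)) s -> annihilates (fun z => f z * (z - y)) s ->
  annihilates f s.+1.
Proof.
move=> s0 xy ax ay; apply: (annihilatesS (a := x)) => //.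
have yx0 : y - x != 0 by rewrite subr_eq0 eq_sym.
apply: (annihilates_lin (c1 := (y - x)^-1) (c2 := - (y - x)^-1) ax ay) => z.
by field.
Qed.

(** [(z - x)^2 - (z - y)^2] is a nonzero constant times [z - m], where [m] is the midpoint. *)
Lemma annihilates_two_sqr f s x y : (1 < s)%N -> x != y ->
  annihilates (fun z => f z * (z - x) * (z - x)) s ->
  annihilates (fun z => f z * (z - y) * (z - y)) s ->
  annihilates f s.+1.
Proof.
case: s => [|[|s]] // _ xy ax ay.
have yx0 : y - x != 0 by rewrite subr_eq0 eq_sym.
pose m := (x + y) / 2%:R.
have am : annihilates (fun z => f z * (z - m)) s.+2.
  pose c := (2%:R * (y - x))^-1.
  apply: (annihilates_lin (c1 := c) (c2 := - c) ax ay) => z.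
  by rewrite /c /m; field; rewrite two_neq0 yx0.
have af : annihilates f s.+1.
  (* [2 x - m] is the reflection of [m] in [x], so [(z - x)^2 - (z - m) (z - (2 x - m))] is the
     constant [(x - m)^2]. *)
  have am' := annihilates_shift (2%:R * x - m) am (ltnSn _).
  have ax' : annihilates (fun z => f z * (z - x) * (z - x)) s.+1.
    apply/annihilatesP => g size_g; move/annihilatesP: ax; apply.
    exact: leqW.
  pose e := ((x - m) ^+ 2)^-1.
  have xm0 : x - m != 0.
    have -> : x - m = (x - y) / 2%:R by rewrite /m; field.
    by rewrite mulf_neq0 ?invr_eq0 ?subr_eq0.
  apply: (annihilates_lin (c1 := e) (c2 := - e) ax' am') => z.
  by rewrite /e; field.
have am1 : annihilates (fun z => f z * (z - m)) s.+1.
  apply/annihilatesP => g size_g; move/annihilatesP: am; apply.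
  exact: leqW.
by apply: (annihilatesS (a := m)) => //; apply: (annihilatesS (a := m)).
Qed.

Lemma card_bigcup_le1 (B : F -> {set F}) X :
  (forall w, w \in X -> #|B w| <= 1)%N -> (#|\bigcup_(w in X) B w| <= #|X|)%N.
Proof.
move=> B1; rewrite -[X in (_ <= X)%N]sum1_card.
elim/big_rec2: _ => [|w m A /B1 leB leA]; first by rewrite cards0.
by rewrite (leq_trans (leq_card_setU _ _)) ?leq_add.
Qed.

Lemma card_le1P (B : {set F}) :
  (forall x y, x \in B -> y \in B -> x != y -> False) -> (#|B| <= 1)%N.
Proof.
move=> B1; apply/card_le1_eqP => x y xB yB; apply/eqP/negPn/negP.
exact: B1.
Qed.

(* Roots of the polynomial are chosen one at a time, so that f never becomes a
   multiple of the evaluation at a point of X or at infinity. *)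
Lemma exists_orthogonal_split f s X : (1 < s)%N -> (2 * (#|X| + s) <= #|F|)%N ->
  ~~ annihilates f s ->
  (forall w, w \in X -> ~~ annihilates (fun x => f x * (x - w)) s) ->
  exists Z, [/\ [disjoint Z & X], #|Z| = s & \sum_x f x * \prod_(z in Z) (x - z) = 0].
Proof.
case: s => [|[|s]] // _; elim: s f X => [|s IHs] f X leF nf nX; last first.
  (* The bad choices of [x], for the conditions at infinity, at the new point [x] and at [w] in [X];
     two bad points of one kind contradict [nf] or [nX]. *)
  pose Binf := [set x | annihilates (fun z => f z * (z - x)) s.+2].
  pose Bsqr := [set x | annihilates (fun z => f z * (z - x) * (z - x)) s.+2].
  pose B w := [set x | annihilates (fun z => f z * (z - x) * (z - w)) s.+2].
  have cinf : (#|Binf| <= 1)%N.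
    apply: card_le1P => x y; rewrite !inE => ax ay xy; case/negP: nf.
    exact: (annihilates_two _ xy ax ay).
  have csqr : (#|Bsqr| <= 1)%N.
    apply: card_le1P => x y; rewrite !inE => ax ay xy; case/negP: nf.
    exact: (annihilates_two_sqr _ xy ax ay).
  have cB : (#|\bigcup_(w in X) B w| <= #|X|)%N.
    apply: card_bigcup_le1 => w wX; apply: card_le1P => x y; rewrite !inE => ax ay xy.
    case/negP: (nX w wX); apply: (annihilates_two _ xy) => //.
      by apply: etrans ax; apply: annihilates_ext => z; rewrite mulrAC.
    by apply: etrans ay; apply: annihilates_ext => z; rewrite mulrAC.
  have [x] : exists x, x \in ~: (X :|: Binf :|: Bsqr :|: \bigcup_(w in X) B w).
    apply/set0Pn; rewrite -card_gt0 cardsCs setCK subn_gt0.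
    rewrite (leq_ltn_trans (leq_card_setU _ _)) //.
    rewrite (leq_ltn_trans (leq_add (leq_card_setU _ _) cB)) //.
    rewrite (leq_ltn_trans (leq_add (leq_add (leq_card_setU _ _) csqr) (leqnn _))) //.
    rewrite (leq_ltn_trans (leq_add (leq_add (leq_add (leqnn _) cinf) (leqnn _)) (leqnn _))) //.
    by apply: leq_trans leF; lia.
  rewrite !inE !negb_or -!andbA => /and4P[xX nxinf nxsqr /bigcupP nxB].
  have [||w|Z [ZX cardZ Z0]] := IHs (fun z => f z * (z - x)) (x |: X).
  - by rewrite cardsU1 xX; apply: leq_trans leF; lia.
  - exact: nxinf.
  - rewrite !inE => /orP[/eqP->|wX]; first exact: nxsqr.
    by apply/negP => aw; apply: nxB; exists w; rewrite ?inE.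
  have xZ : x \notin Z.
    by apply/negP => xZ; move: ZX; rewrite disjoint_sym disjoints_subset subUset sub1set inE xZ.
  exists (x |: Z); split.
  - rewrite disjoints_subset subUset sub1set inE xX -disjoints_subset.
    by rewrite (disjointWr _ ZX) // subsetUr.
  - by rewrite cardsU1 xZ cardZ.
  - by apply: etrans Z0; apply: eq_bigr => y _; rewrite big_setU1 //= mulrA.
(* Two roots remain: [phi x y] is the value of the functional at [('X - x) * ('X - y)]. Outside [B1]
   it can be solved for [y]; avoiding [B2] and the [B w] makes [y] differ from [x] and from the
   points of [X]. *)
pose S0 := \sum_x f x; pose S1 := \sum_x f x * x; pose S2 := \sum_x f x * x ^+ 2.
pose phi x y := S2 - (x + y) * S1 + x * y * S0.
have ann2 g : annihilates g 2 = (\sum_x g x == 0) && (\sum_x g x * x == 0).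
  apply/annihilatesP/andP => [ann|[/eqP g0 /eqP g1] h size_h].
    split; apply/eqP.
      by rewrite -[RHS](ann 1) ?size_poly1 //; apply: eq_bigr => x _; rewrite hornerC mulr1.
    by rewrite -[RHS](ann 'X) ?size_polyX //; apply: eq_bigr => x _; rewrite hornerX.
  transitivity (h`_0 * (\sum_x g x) + h`_1 * (\sum_x g x * x)); last first.
    by rewrite g0 g1 !mulr0 addr0.
  rewrite !mulr_sumr -big_split; apply: eq_bigr => x _.
  by rewrite (horner_coef_wide _ size_h) !big_ord_recl big_ord0 /= expr0 expr1; ring.
have S1E w : \sum_x f x * (x - w) = S1 - w * S0.
  by rewrite mulr_sumr -sumrB; apply: eq_bigr => x _; ring.
have S2E w : \sum_x f x * (x - w) * x = S2 - w * S1.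
  by rewrite mulr_sumr -sumrB; apply: eq_bigr => x _; ring.
have phiE x y : \sum_z f z * ((z - x) * (z - y)) = phi x y.
  by rewrite /phi !mulr_sumr -sumrB -big_split; apply: eq_bigr => z _ /=; ring.
pose B1 := [set x | S1 - x * S0 == 0].
pose B2 := [set x | phi x x == 0].
pose B w := [set x | phi x w == 0].
have cB1 : (#|B1| <= 1)%N.
  apply: card_le1P => x y; rewrite !inE => /eqP ex /eqP ey xy.
  move: nf; rewrite ann2 -/S0 -/S1 => /negP; apply.
  have /eqP : (x - y) * S0 = 0.
    by transitivity ((S1 - y * S0) - (S1 - x * S0)); [ring | rewrite ex ey subrr].
  rewrite mulf_eq0 subr_eq0 (negPf xy) /= => /eqP S00.
  by move: ex; rewrite S00 mulr0 subr0 => ->; rewrite eqxx.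
have cB2 : (#|B2| <= 2)%N.
  pose P := Poly [:: S2; - (2%:R * S1); S0].
  have P0 : P != 0.
    apply: contraNneq nf => P0; rewrite ann2 -/S0 -/S1.
    have := congr1 (fun p : {poly F} => p`_1) P0; rewrite coef_Poly coef0 /= => /eqP.
    rewrite oppr_eq0 mulf_eq0 (negPf two_neq0) /= => ->; rewrite andbT.
    by have := congr1 (fun p : {poly F} => p`_2) P0; rewrite coef_Poly coef0 /= => ->.
  rewrite cardE -ltnS (leq_trans (max_poly_roots P0 _ (enum_uniq _))) ?size_Poly //.
  apply/allP => x; rewrite mem_enum inE rootE horner_Poly => /eqP e.
  by rewrite -[X in _ == X]e /phi /=; apply/eqP; ring.
have cB : (#|\bigcup_(w in X) B w| <= #|X|)%N.
  apply: card_bigcup_le1 => w wX; apply: card_le1P => x y; rewrite !inE => /eqP ex /eqP ey xy.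
  case/negP: (nX w wX); rewrite ann2 S1E S2E.
  have /eqP : (x - y) * (S1 - w * S0) = 0.
    by transitivity (phi y w - phi x w); [rewrite /phi; ring | rewrite ex ey subrr].
  rewrite mulf_eq0 subr_eq0 (negPf xy) /= => /eqP S10.
  have -> : S2 - w * S1 = phi x w + x * (S1 - w * S0) by rewrite /phi; ring.
  by rewrite ex S10 mulr0 addr0 eqxx.
have [x] : exists x, x \in ~: (X :|: B1 :|: B2 :|: \bigcup_(w in X) B w).
  apply/set0Pn; rewrite -card_gt0 cardsCs setCK subn_gt0.
  rewrite (leq_ltn_trans (leq_card_setU _ _)) //.
  rewrite (leq_ltn_trans (leq_add (leq_card_setU _ _) cB)) //.
  rewrite (leq_ltn_trans (leq_add (leq_add (leq_card_setU _ _) cB2) (leqnn _))) //.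
  rewrite (leq_ltn_trans (leq_add (leq_add (leq_add (leqnn _) cB1) (leqnn _)) (leqnn _))) //.
  by apply: leq_trans leF; lia.
rewrite !inE !negb_or -!andbA => /and4P[xX x1 x2 /bigcupP nxB].
pose y := (S2 - x * S1) / (S1 - x * S0).
have phixy : phi x y = 0 by rewrite /y /phi; field.
have yx : y != x by apply: contraNneq x2 => yx; rewrite -{2}yx phixy.
have yX : y \notin X.
  by apply/negP => yX; apply: nxB; exists y; rewrite ?inE ?phixy.
exists [set x; y]; split.
- by rewrite disjoints_subset subUset !sub1set !inE xX.
- by rewrite cards2 eq_sym yx.
- rewrite -[RHS]phixy -phiE; apply: eq_bigr => z _.
  by rewrite big_setU1 ?inE 1?eq_sym // big_set1.
Qed.
End SeroussiRoth.

(** * Vanishing divided differences and agreement with codewords *)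

Section Completeness.
Variables (F : finFieldType) (k : nat).
Hypothesis k_gt1 : (1 < k)%N.
Implicit Types (f : F -> F) (C : {set F}).

(** On k + 1 points, [f] then agrees with a polynomial of degree below k; on k points, with one of
    degree below k - 1, which also agrees with the value 0 at infinity. *)
Definition vanishing_ddiff f : bool :=
  [exists C : {set F}, ((#|C| == k) || (#|C| == k.+1)) && (ddiff f C == 0)].

Lemma not_vanishing_ddiff f : ~~ vanishing_ddiff f ->
  (forall C, #|C| = k -> ddiff f C != 0) * (forall C, #|C| = k.+1 -> ddiff f C != 0).
Proof.
rewrite negb_exists => /forallP nv.
by split=> C cardC; have := nv C; rewrite cardC eqxx ?orbT.
Qed.

(** Here n = k - 1: the set [G] takes 2 k - 2 points, and the integers inverted go up to n + 1 =
    k. *)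
Lemma vanishing_ddiff_small f : (2 * k <= #|F|.+2)%N ->
  (forall m, (1 < m <= k)%N -> m%:R != 0 :> F) -> vanishing_ddiff f.
Proof.
move=> leF natr0; case: (boolP (vanishing_ddiff f)) => // /not_vanishing_ddiff[].
rewrite -(ltn_predK k_gt1) => ddk ddk1.
have n_gt0 : (0 < k.-1)%N by lia.
have [G _ cardG] : exists2 G : {set F}, G \subset [set: F] & #|G| = k.-1.*2.
  by apply: exists_subset; rewrite cardsT -addnn; move: leF; set q := #|_|; lia.
have [V V_lift] := cross_lift ddk ddk1 n_gt0 cardG.
case: (cross_not_lifted_small n_gt0 cardG V_lift) => m.
by rewrite (ltn_predK k_gt1); apply: natr0.
Qed.

(** There are k - 1 = m + 1 pairs, so 3 m + 2 <= q reads 3 k <= q + 4. *)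
Lemma vanishing_ddiff_medium f : 2%:R != 0 :> F -> (3 * k <= #|F| + 4)%N ->
  vanishing_ddiff f.
Proof.
move=> two0 leF; case: (boolP (vanishing_ddiff f)) => // /not_vanishing_ddiff[].
rewrite -(ltn_predK k_gt1) => ddk ddk1.
have n_gt0 : (0 < k.-1)%N by lia.
case: (@kern_sum_not_all_zero F k.-2 two0) => [|L]; first by lia.
rewrite prednK // => sizeL uL.
have cardG : #|[set x in points L]| = k.-1.*2.
  by rewrite cardsE (card_uniqP uL) size_cat !size_map addnn sizeL.
have [V V_lift] := cross_lift ddk ddk1 n_gt0 cardG.
by apply: (sum_kern_eq0 uL) => D DG; rewrite sizeL; apply: V_lift.
Qed.

(** Off [C] the product is 0; on [C], Wilson's theorem makes it minus the inverse of
    [\prod_(d in C :\ x) (x - d)]. *)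
Lemma sum_prod_setC f C :
  \sum_x f x * \prod_(z in ~: C) (x - z) = - ddiff f C.
Proof.
rewrite (bigID (mem C)) /= [X in _ + X]big1 ?addr0 => [|x xC]; last first.
  by rewrite (big_setD1 x) ?inE //= subrr mul0r mulr0.
rewrite /ddiff -sumrN; apply: eq_bigr => x xC.
have p0 : \prod_(d in C :\ x) (x - d) != 0.
  by apply: (prod_sub_neq0 (t := id)) => d /setD1P[].
have wil : \prod_(z in ~: C) (x - z) * \prod_(d in C :\ x) (x - d) = -1.
  rewrite -(prod_sub_all x) [RHS](big_setID C) /= mulrC; congr (_ * _); apply: eq_bigl => z.
    by rewrite !inE andbC.
  by rewrite !inE; case: (z =P x) => [->|]; rewrite ?xC ?andbT.
by rewrite -(mulfK p0 (\prod_(z in ~: C) (x - z))) wil mulrA mulrN1 mulNr.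
Qed.

(** [exists_orthogonal_split] with [X] empty and s = q - k: the bounds say that 1 < s and 2 s <= q,
    and the complement of [Z] has k points. *)
Lemma vanishing_ddiff_large f : 2%:R != 0 :> F -> (k + 2 <= #|F|)%N ->
  (#|F| <= 2 * k)%N -> vanishing_ddiff f.
Proof.
move=> two0 leF geF; case: (boolP (vanishing_ddiff f)) => // /not_vanishing_ddiff[ddk ddk1].
set q := #|F| in leF geF.
have cardSC C : #|~: C| = (q - #|C|)%N by rewrite cardsCs setCK.
have nann : ~~ annihilates f (q - k).
  have [C _ cardC] : exists2 C : {set F}, C \subset [set: F] & #|C| = k.+1.
    by apply: exists_subset; rewrite cardsT -/q; lia.
  apply: contra (ddk1 C cardC) => /annihilatesP ann.
  rewrite -oppr_eq0 -sum_prod_setC.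
  rewrite -[X in _ == X](ann (\prod_(z in ~: C) ('X - z%:P))).
    by apply/eqP/eq_bigr => x _; rewrite horner_prod_XsubC.
  by rewrite size_prod_XsubC_in cardSC cardC; lia.
have [||w|Z [_ cardZ Z0]] := exists_orthogonal_split two0 (s := (q - k)%N) (X := set0) _ _ nann.
- by lia.
- by rewrite cards0 -/q; lia.
- by rewrite inE.
have := ddk (~: Z); rewrite cardSC cardZ -oppr_eq0 -sum_prod_setC setCK Z0 eqxx.
by move=> absurd; suff /absurd : (q - (q - k))%N = k; lia.
Qed.

(** Subtracting [c * x ^+ k.-1] normalises the value at infinity to 0; the term is added back to the
    interpolant. *)
Lemma vanishing_ddiff_agreement (f : F -> F) (c : F) :
  vanishing_ddiff (fun x => f x - c * x ^+ k.-1) ->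
  exists2 g : {poly F}, (size g <= k)%N &
    (k < #|[set x | g.[x]%R == f x]| + ((g`_k.-1)%R == c))%N.
Proof.
set f' := fun x => _; case/existsP => C /andP[cardC /eqP ddC].
have id_inj : {in C &, injective (@id F)} by [].
have [g0 [size_g0 g0E]] := lagrange_interpolation f' id_inj.
rewrite -/(ddiff f' C) ddC => lead0.
have size_g0k : (size g0 <= k)%N.
  case/orP: cardC => /eqP cardC; rewrite cardC in size_g0 lead0 => //.
  rewrite leqNgt; apply/negP => ltk.
  have eqk : size g0 = k.+1 by apply/eqP; rewrite eqn_leq size_g0.
  have : lead_coef g0 = 0 by rewrite lead_coefE eqk.
  by move/eqP; rewrite lead_coef_eq0 => /eqP g00; rewrite g00 size_poly0 in eqk.
exists (g0 + c *: 'X^(k.-1)).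
  rewrite (leq_trans (size_polyD _ _)) // geq_max size_g0k.
  by rewrite (leq_trans (size_scale_leq _ _)) // size_polyXn; lia.
have leC : (#|C| <= #|[set x | ((g0 + c *: 'X^(k.-1)).[x] == f x)%R]|)%N.
  apply/subset_leq_card/subsetP => x xC; rewrite inE !hornerE g0E //.
  by rewrite /f' subrK.
rewrite coefD coefZ coefXn eqxx mulr1.
case/orP: cardC => /eqP cardC; rewrite cardC in leC lead0.
  by rewrite lead0 add0r eqxx addn1.
exact: leq_trans leC (leq_addr _ _).
Qed.

End Completeness.

(** * The covering radius *)

Section CoveringRadius.
Variables (F : finFieldType) (q : nat) (alpha : 'I_q -> F).
Hypothesis alpha_bij : bijective alpha.

Lemma bigminn_leq (I : finType) (P : pred I) (h : I -> nat) n j :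
  P j -> (\big[minn/n]_(i | P i) h i <= h j)%N.
Proof.
move=> Pj; have : j \in index_enum I by rewrite mem_index_enum.
elim: (index_enum I) => // i s IHs; rewrite inE big_cons => /orP[/eqP<-|/IHs leh].
  by rewrite Pj geq_minl.
by case: (P i) => //; rewrite geq_min leh orbT.
Qed.

Lemma hamming_prs_word (u : 'rV[F]_(q + 1)) (h : F -> F) k (g : {poly F}) :
  (forall i, u 0 (lshift 1 i) = h (alpha i)) ->
  (hamming u (prs_word alpha k g) +
   (#|[set x | g.[x]%R == h x]| + ((g`_k.-1)%R == u 0%R (rshift q 0%R))))%N = (q + 1)%N.
Proof.
move=> uE; rewrite -[RHS]card_ord.
rewrite -(cardsC [set i | u 0 i != prs_word alpha k g 0 i]); congr (_ + _)%N.
rewrite -!sum1dep_card [RHS]big_mkcond big_split_ord /= big_ord1.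
congr (_ + _)%N.
  rewrite (reindex alpha) /=; last exact: onW_bij.
  rewrite big_mkcond; apply: eq_bigr => i _.
  by rewrite !inE negbK uE row_mxEl mxE eq_sym.
by rewrite !inE negbK row_mxEr mxE eq_sym; case: eqP.
Qed.

Lemma covering_radius_PRS k : (1 < k < q)%N ->
  (forall f : F -> F, vanishing_ddiff k f) ->
  covering_radius (PRS alpha k) = (q - k)%N.
Proof.
case/andP=> k_gt1 kq vanish; have [beta alphaK betaK] := alpha_bij.
apply/eqP; rewrite eqn_leq; apply/andP; split.
  apply/bigmax_leqP => u _.
  pose h x := u 0 (lshift 1 (beta x)).
  have [g size_g agree] := vanishing_ddiff_agreement k_gt1 (vanish
    (fun x => h x - u 0 (rshift q 0) * x ^+ k.-1)).
  have inC : prs_word alpha k g \in PRS alpha k.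
    by apply/imsetP; exists (NPoly size_g).
  apply: leq_trans (bigminn_leq _ _ inC) _.
  have := hamming_prs_word k g (fun i =>
    congr1 (fun j => u 0 (lshift 1 j)) (esym (alphaK i)) : _ = h (alpha i)).
  by move: agree; set a := (_ + _)%N; lia.
(* A deep hole: ['X^k - g] has degree k, so [u] agrees with a codeword in at most k finite
   coordinates and possibly at infinity. *)
pose u : 'rV[F]_(q + 1) := row_mx (\row_i alpha i ^+ k) 0.
apply: leq_trans (leq_bigmax u).
(* The default value q + 1 of the minimum also satisfies the bound. *)
rewrite /dist_code; apply: (big_ind (fun m => q - k <= m)%N); first by lia.
  by move=> m1 m2 le1 le2; rewrite leq_min le1.
move=> _ /imsetP[[g gk] _ ->] /=; have size_g : (size g <= k)%N := gk.
have uE i : u 0 (lshift 1 i) = alpha i ^+ k by rewrite row_mxEl mxE.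
have := hamming_prs_word (h := fun x => x ^+ k) k g uE.
have agree : (#|[set x | g.[x]%R == (x ^+ k)%R]| <= k)%N.
  have size_Xg : size ('X^k - g)%R = k.+1.
    by rewrite size_polyDl ?size_polyXn // size_polyN ltnS size_g.
  rewrite cardE -ltnS -size_Xg; apply: max_poly_roots; rewrite ?enum_uniq //.
    by rewrite -size_poly_eq0 size_Xg.
  apply/allP => x; rewrite mem_enum inE rootE !hornerE => /eqP->.
  by rewrite subrr.
by move: agree; set c := #|_|; case: (_ == _); lia.
Qed.

End CoveringRadius.

Theorem theoremI5 (F : finFieldType) (p q : nat)
    (p_char : p \in [pchar F]) (p_odd : odd p) (card_F : #|F| = q)
    (alpha : 'I_q -> F) (alpha_bij : bijective alpha) :
  (q = p ->
     forall k : nat, (2 <= k)%N -> (k <= p - 2)%N ->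
       covering_radius (PRS alpha k) = (p - k)%N) /\
  (q = (p ^ 2)%N ->
     forall k : nat, (2 <= k)%N -> (k <= 2 * p - 3)%N ->
       covering_radius (PRS alpha k) = (q - k)%N).
Proof.
have natr0 m : (0 < m < p)%N -> m%:R != 0 :> F.
  by case/andP=> m_gt0 mp; rewrite -(dvdn_pcharf p_char) gtnNdvd.
have p_gt2 : (2 < p)%N.
  by rewrite odd_prime_gt2 // (pcharf_prime p_char).
have two0 : 2%:R != 0 :> F by rewrite natr0.
split=> q_eq k k_gt1 k_le.
  rewrite -q_eq in k_le natr0 *; apply: covering_radius_PRS => [//||f]; first by lia.
  (* In the small case k < p makes 2, ..., k invertible; otherwise q <= 2 k. *)
  have [small|large] := leqP (2 * k) q.+2.
    apply: vanishing_ddiff_small; rewrite ?card_F // => m /andP[m_gt1 m_le].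
    by rewrite natr0 //; lia.
  by apply: vanishing_ddiff_large; rewrite ?card_F //; lia.
(* This is (p - 3)^2 >= 0; with k <= 2 p - 3 it gives 3 k <= 6 p - 9 <= q. *)
have q_ge : (6 * p <= q + 9)%N by rewrite q_eq; nia.
apply: covering_radius_PRS => [//||f]; first by lia.
by apply: vanishing_ddiff_medium; rewrite ?card_F //; lia.
Qed.
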